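(* Let $q=3$ and $n>1$. Then the torsion subgroup $\mathrm{tor}\,H^R_n(R_q)$ of the $n$th rack homology group of the dihedral quandle $R_q$ is annihilated by $q$.
   Context: $\mathbb{Z}_k=\mathbb{Z}/k\mathbb{Z}$. The dihedral quandle $R_k$ is the set $\mathbb{Z}_k$ with the operation $a*b=2b-a$. For a rack $X$ (a set with a binary operation $*$ such that for every $b$ the map $a\mapsto a*b$ is a bijection and $(a*b)*c=(a*c)*(b*c)$ for all $a,b,c$), the rack chain complex is defined as follows. For $n\ge 1$, $C_n^R(X)$ is the free abelian group generated by $n$-tuples $(x_1,\dots,x_n)$ of elements of $X$, with boundary homomorphism $\partial: C^R_n(X)\to C^R_{n-1}(X)$, $$\partial(x_1,\ldots,x_n)=\sum_{i=2}^n(-1)^i\big((x_1,\ldots,x_{i-1},x_{i+1},\ldots,x_n)-(x_1*x_i,\ldots,x_{i-1}*x_i,x_{i+1},\ldots,x_n)\big)$$ (so $\partial=0$ on $C_1^R(X)$). Rack homology $H_n^R(X)$ is the homology of $(C_*^R(X),\partial)$. *)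

(* Defs.v *)
From HB Require Import structures.
From mathcomp.multinomials Require Import freeg.
From mathcomp Require Import all_boot all_order all_algebra.
From mathcomp Require Import boolp.

Set Implicit Arguments.
Unset Strict Implicit.
Unset Printing Implicit Defensive.

Import GRing.Theory.
Local Open Scope ring_scope.

HB.mixin Record isRack X := {
  rack_op : X -> X -> X;
  rack_op_bij : forall b, bijective (rack_op^~ b);
  rack_op_dist : forall a b c,
    rack_op (rack_op a b) c = rack_op (rack_op a c) (rack_op b c)
}.

#[short(type="rackType")]
HB.structure Definition Rack := {X of isRack X & Choice X}.

(* 'Z_k is Z/kZ only for k > 1. *)
Definition dihedral (k : nat) : Type := 'Z_k.

HB.instance Definition _ k := Finite.on (dihedral k).
HB.instance Definition _ k := GRing.Zmodule.on (dihedral k).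

Definition dihedral_op k (a b : dihedral k) : dihedral k := b *+ 2 - a.

Lemma dihedral_op_bij k (b : dihedral k) : bijective ((@dihedral_op k)^~ b).
Proof. by exists ((@dihedral_op k)^~ b) => a; rewrite /dihedral_op subKr. Qed.

Lemma dihedral_op_dist k (a b c : dihedral k) :
  dihedral_op (dihedral_op a b) c =
  dihedral_op (dihedral_op a c) (dihedral_op b c).
Proof.
rewrite /dihedral_op mulrnBl !opprB [RHS]addrC.
by rewrite (mulr2n (c *+ 2)) -[c *+ 2 + _ - _]addrA subrKA addrCA.
Qed.

HB.instance Definition _ k :=
  isRack.Build (dihedral k) (@dihedral_op_bij k) (@dihedral_op_dist k).

Section Homology.

Variables (A B C : zmodType) (d' : {additive A -> B}) (d : {additive B -> C}).

Definition cycle : {pred B} := [pred z | d z == 0].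

Fact cycle_zmod_closed : zmod_closed cycle.
Proof.
split=> [|x y]; rewrite !inE ?raddf0 // => /eqP dx /eqP dy.
by rewrite raddfB dx dy subrr.
Qed.

HB.instance Definition _ := GRing.isZmodClosed.Build B cycle cycle_zmod_closed.

Record cycles := Cycles { cycle_val :> B; _ : cycle_val \in cycle }.

HB.instance Definition _ := [isSub for cycle_val].
HB.instance Definition _ := [Choice of cycles by <:].
HB.instance Definition _ := [SubChoice_isSubZmodule of cycles by <:].

(* The quotient below is ker d / (ker d :&: im d'), which is ker d / im d' as
   soon as d \o d' = 0. Membership in im d' is decided classically. *)
Definition boundaries : {pred cycles} :=
  [pred z | `[< exists w, d' w = val z >]].

Fact boundaries_zmod_closed : zmod_closed boundaries.
Proof.
split=> [|x y]; rewrite !inE; first by apply/asboolP; exists 0; rewrite !raddf0.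
move=> /asboolP[u du] /asboolP[v dv]; apply/asboolP.
by exists (u - v); rewrite !raddfB /= du dv.
Qed.

HB.instance Definition _ :=
  GRing.isZmodClosed.Build cycles boundaries boundaries_zmod_closed.

Definition homology : zmodType := Quotient.quot boundaries.

End Homology.

Section RackHomology.

Variable X : rackType.

Definition rack_chain (n : nat) : zmodType := {freeg (n.-tuple X) / int}.

Section Boundary.

Variable n : nat.

(* Positions are counted from 0, so the entries of [x] before position [i]
   are those at [lift i j] with [lift i j < i]. *)
Definition rack_face0 (i : 'I_n) (x : n.-tuple X) : n.-1.-tuple X :=
  [tuple tnth x (lift i j) | j < n.-1].

Definition rack_face1 (i : 'I_n) (x : n.-tuple X) : n.-1.-tuple X :=
  [tuple (if (lift i j < i)%N then rack_op (tnth x (lift i j)) (tnth x i)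
          else tnth x (lift i j)) | j < n.-1].

(* The position [i] is the index i + 1 of the usual formula, whose sum starts
   at 2. *)
Definition rack_boundary_gen (x : n.-tuple X) : {freeg (n.-1.-tuple X) / int} :=
  \sum_(i < n | (0 < i)%N)
    (-1) ^+ i.+1 *: (<< rack_face0 i x >> - << rack_face1 i x >>).

Definition rack_boundary (c : rack_chain n) : rack_chain n.-1 :=
  fglift rack_boundary_gen c.

Fact rack_boundary_is_zmod_morphism : zmod_morphism rack_boundary.
Proof. exact: lift_is_additive. Qed.

HB.instance Definition _ :=
  GRing.isZmodMorphism.Build (rack_chain n) (rack_chain n.-1) rack_boundary
    rack_boundary_is_zmod_morphism.

End Boundary.

(* Meaningful for n > 0 only: the usual complex has no term in degree 0. As
   rack_boundary vanishes on 1-chains, the extra term [rack_chain 0] does not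
   affect the groups of positive degree. *)
Definition rack_homology (n : nat) : zmodType :=
  homology (@rack_boundary n.+1) (@rack_boundary n).

End RackHomology.

Definition torsion (A : zmodType) (a : A) : Prop :=
  exists2 m : nat, (0 < m)%N & a *+ m = 0.

(* Main.v *)
(* For a finite quasigroup quandle X, multiplication by #|X| on the rack complex
   is chain homotopic to a map that only sees the augmentation of a chain, and
   the augmentation of a torsion cycle vanishes. Consider
     T_j (x) = (x_j, ..., x_j, x_(j+1), ..., x_n)   and
     S_j (x) = sum_y (y, ..., y, x_(j+1), ..., x_n)
   with j equal entries in front. By idempotence, removing one of them gives
   cancelling faces. Inserting y after the j copies of x_j, and summing over y,
   gives a homotopy #|X| T_j ~ S_j because x_j * y runs over X. Inserting after
   the j copies of y the element u with y * u = x_(j+1) gives a homotopy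
   S_j ~ #|X| T_(j+1). Since T_1 is the identity, #|X| ~ S_n. *)

Require Import Defs.
From HB Require Import structures.
From mathcomp.multinomials Require Import freeg.
From mathcomp Require Import all_boot all_order all_algebra.
From mathcomp Require Import generic_quotient boolp zify.

Set Implicit Arguments.
Unset Strict Implicit.
Unset Printing Implicit Defensive.

Import GRing.Theory.
Local Open Scope quotient_scope.
Local Open Scope ring_scope.

(** * Additive maps out of free abelian groups *)

HB.instance Definition _ (K : choiceType) (M : lmodType int) (f : K -> M) :=
  GRing.isZmodMorphism.Build {freeg K / int} M (fglift f) (lift_is_additive f).

Lemma raddf_scalez (M N : lmodType int) (A : {additive M -> N}) (a : int) x :
  A (a *: x) = a *: A x.
Proof. by rewrite -[a]intz !scaler_int raddfMz. Qed.

Section FreeAbelianGroup.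

Variable K : choiceType.

Lemma fgliftE (M : lmodType int) (f : K -> M) (c : {freeg K / int}) :
  fglift f c = \sum_(x <- dom c) coeff x c *: f x.
Proof.
rewrite -[in LHS](freeg_sumE c) raddf_sum.
by apply: eq_bigr => x _ /=; rewrite liftU.
Qed.

Lemma raddf_fglift (M N : lmodType int) (A : {additive M -> N}) (f : K -> M)
    (c : {freeg K / int}) :
  A (fglift f c) = fglift (A \o f) c.
Proof.
by rewrite !fgliftE raddf_sum; apply: eq_bigr => x _; rewrite raddf_scalez.
Qed.

End FreeAbelianGroup.

#[short(type="finRackType")]
HB.structure Definition FinRack := {X of Rack X & Finite X}.

(* Repeated so that the structure just declared is inferred for [dihedral]. *)
HB.instance Definition _ k := Finite.on (dihedral k).

(** * Torsion classes and the cycles representing them *)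

Section Homology.

Variables (A B C : zmodType) (d' : {additive A -> B}) (d : {additive B -> C}).

Lemma pi_homology_eq0 (z : cycles d) :
  \pi_(Quotient.quot (boundaries d' (d := d))) z = 0 <->
  exists w, d' w = val z.
Proof.
split=> [z0 | dw].
  apply/asboolP; change (z \in boundaries d' (d := d)).
  by rewrite -[z]subr0 Quotient.idealrBE z0 raddf0.
apply/eqP; rewrite -(raddf0 (\pi_(Quotient.quot (boundaries d' (d := d))))).
by rewrite -Quotient.idealrBE subr0; apply/asboolP.
Qed.

(** Passes from classes to chains: a class killed by [p] is represented by a cycle [z] such that
    [z *+ p] bounds. *)
Lemma torsion_homology k (h : homology d' d) :
    (forall z p w, d z = 0 -> (0 < p)%N -> d' w = z *+ p ->
      exists v, d' v = z *+ k) ->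
  torsion h -> h *+ k = 0.
Proof.
move=> killed; elim/quotW: h => z [p p_gt0].
rewrite -!raddfMn => /pi_homology_eq0[w dw]; apply/pi_homology_eq0.
have dz : d (val z) = 0 by apply/eqP; exact: valP z.
by rewrite raddfMn; apply: (killed _ p w); rewrite // dw raddfMn.
Qed.

End Homology.

(** * Tuples with a repeated initial entry, and their faces *)

Section Tuples.

Variables (X : rackType) (x0 : X).
Implicit Types (a u : X).

(** With [a] the entry of [x] at position [j.-1] this is T_j; summed over all [a] it is S_j. *)
Definition collapse n j a (x : n.-tuple X) : n.-tuple X :=
  [tuple (if (i < j)%N then a else tnth x i) | i < n].

(** The default [a] of [nth] is never reached: the last branch has [j < i <= n], so [i.-1 < n]. *)
Definition insertion n j a u (x : n.-tuple X) : n.+1.-tuple X :=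
  [tuple (if (i < j)%N then a else if i == j :> nat then u else nth a x i.-1)
     | i < n.+1].

(** Since [g] must take the default value from [n] on, [k] is arbitrary, and the formulas for faces
    need no bound on the index. *)
Lemma nth_mktuple_default n (f : 'I_n -> X) (g : nat -> X) k :
    (forall i : 'I_n, f i = g i) -> (n <= k -> g k = x0)%N ->
  nth x0 [tuple f i | i < n] k = g k.
Proof.
move=> fg gk; case: (ltnP k n) => [lt_kn | le_nk].
  by rewrite (nth_mktuple f x0 (Ordinal lt_kn)) fg.
by rewrite nth_default ?size_tuple ?gk.
Qed.

Lemma nth_collapse n j a (x : n.-tuple X) k : (k < n)%N ->
  nth x0 (collapse j a x) k = if (k < j)%N then a else nth x0 x k.
Proof.
by move=> lt_kn; rewrite (nth_mktuple _ _ (Ordinal lt_kn)) (tnth_nth x0).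
Qed.

Lemma nth_insertion n j a u (x : n.-tuple X) k : (k <= n)%N ->
  nth x0 (insertion j a u x) k =
  if (k < j)%N then a else if k == j then u else nth x0 x k.-1.
Proof.
move=> le_kn; rewrite (nth_mktuple _ _ (Ordinal (le_kn : (k < n.+1)%N))) /=.
by case: ltngtP => // lt_jk; apply: set_nth_default; rewrite size_tuple; lia.
Qed.

Lemma nth_face0 n (i : 'I_n.+1) (x : n.+1.-tuple X) k :
  nth x0 (rack_face0 i x) k = nth x0 x (if (k < i)%N then k else k.+1).
Proof.
rewrite (@nth_mktuple_default _ _
  (fun k => nth x0 x (if (k < i)%N then k else k.+1))) //.
  move=> l; rewrite (tnth_nth x0) /= /bump; congr nth.
  by case: ltnP => ?; lia.
move=> le_nk; rewrite nth_default // size_tuple; have := ltn_ord i.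
by case: (ltnP k i); lia.
Qed.

Lemma nth_face1 n (i : 'I_n.+1) (x : n.+1.-tuple X) k :
  nth x0 (rack_face1 i x) k =
  if (k < i)%N then rack_op (nth x0 x k) (nth x0 x i) else nth x0 x k.+1.
Proof.
rewrite (@nth_mktuple_default _ _ (fun k => if (k < i)%N
   then rack_op (nth x0 x k) (nth x0 x i) else nth x0 x k.+1)) //.
  move=> l; rewrite !(tnth_nth x0) /= /bump.
  rewrite (leqNgt i l); case: (ltnP l i) => li; rewrite /= ?add0n ?add1n ?li //.
  by rewrite ltnNge (leqW li).
move=> le_nk; have := ltn_ord i; case: (ltnP k i) => ? ?; first lia.
by rewrite nth_default // size_tuple; lia.
Qed.

Lemma eq_tuple_nth n (s t : n.-tuple X) :
  (forall k, (k < n)%N -> nth x0 s k = nth x0 t k) -> s = t.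
Proof. by move=> st; apply/eq_from_tnth => i; rewrite !(tnth_nth x0) st. Qed.

End Tuples.

(** * Boundaries of insertions and the homotopies they define *)

Section Homotopy.

Variables (X : finRackType) (x0 : X).
Hypothesis rack_opxx : forall a : X, rack_op a a = a.
Implicit Types (a u : X) (m n j : nat).

(** The removed entry and all entries before it are copies of [a], on which [a] acts trivially by
    idempotence. *)
Lemma face0_insertion_lt m j a u (x : m.+1.-tuple X) (i : 'I_m.+2) :
  (i < j <= m.+1)%N ->
  rack_face0 i (insertion j a u x) = rack_face1 i (insertion j a u x).
Proof.
move=> /andP[lt_ij le_jm]; apply: (@eq_tuple_nth _ x0) => k lt_km.
rewrite nth_face0 nth_face1; case: (ltnP k i) => // lt_ki.
rewrite !nth_insertion; try lia.
by rewrite lt_ij (ltn_trans lt_ki lt_ij) rack_opxx.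
Qed.

Lemma face0_insertion_eq m j a u (x : m.+1.-tuple X) (i : 'I_m.+2) :
  i = j :> nat -> rack_face0 i (insertion j a u x) = collapse j a x.
Proof.
move=> ij; have le_jm : (j <= m.+1)%N by rewrite -ij -ltnS.
apply: (@eq_tuple_nth _ x0) => k lt_km.
rewrite nth_face0 nth_collapse // ij.
case: (ltnP k j) => [lt_kj | le_jk]; rewrite nth_insertion ?lt_kj //; try lia.
by rewrite ltnNge (leqW le_jk) /= gtn_eqF.
Qed.

Lemma face1_insertion_eq m j a u (x : m.+1.-tuple X) (i : 'I_m.+2) :
  i = j :> nat ->
  rack_face1 i (insertion j a u x) = collapse j (rack_op a u) x.
Proof.
move=> ij; have le_jm : (j <= m.+1)%N by rewrite -ij -ltnS.
apply: (@eq_tuple_nth _ x0) => k lt_km.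
rewrite nth_face1 nth_collapse // ij.
case: (ltnP k j) => [lt_kj | le_jk];
  rewrite !nth_insertion ?lt_kj ?ltnn ?eqxx //; try lia.
by rewrite ltnNge (leqW le_jk) /= gtn_eqF.
Qed.

(** The inserted entry pushes the one at [i'] to position [i'.+1]. *)
Lemma face0_insertion_gt m j a u (x : m.+1.-tuple X) (i : 'I_m.+2)
    (i' : 'I_m.+1) : i = i'.+1 :> nat -> (j <= i')%N ->
  rack_face0 i (insertion j a u x) = insertion j a u (rack_face0 i' x).
Proof.
move=> ii' le_ji; have lt_im := ltn_ord i'.
apply: (@eq_tuple_nth _ x0) => k lt_km.
rewrite nth_face0 [RHS]nth_insertion // nth_face0 ii'.
case: (ltnP k i'.+1) => ki; rewrite nth_insertion /=; try lia.
  by case: ltngtP => // kj; have -> : (k.-1 < i')%N by lia.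
have -> : (k.+1 < j)%N = false by lia.
have -> : (k.+1 == j) = false by lia.
have -> : (k < j)%N = false by lia.
have -> : (k == j) = false by lia.
have -> : (k.-1 < i')%N = false by lia.
by congr nth; lia.
Qed.

Lemma face1_insertion_gt m j a u (x : m.+1.-tuple X) (i : 'I_m.+2)
    (i' : 'I_m.+1) : i = i'.+1 :> nat -> (j <= i')%N ->
  rack_face1 i (insertion j a u x) =
  insertion j (rack_op a (tnth x i')) (rack_op u (tnth x i')) (rack_face1 i' x).
Proof.
move=> ii' le_ji; have lt_im := ltn_ord i'.
apply: (@eq_tuple_nth _ x0) => k lt_km.
rewrite nth_face1 !nth_insertion ?nth_face1 ?ii' ?(tnth_nth x0) /=; try lia.
have -> : (i'.+1 < j)%N = false by lia.
have -> : (i'.+1 == j) = false by lia.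
case: (ltngtP k j) => kj; case: (ltnP k i'.+1) => ki //; try lia.
- by have -> : (k.-1 < i')%N by lia.
- have -> : (k.+1 < j)%N = false by lia.
  have -> : (k.+1 == j) = false by lia.
  have -> : (k.-1 < i')%N = false by lia.
  by congr nth; lia.
Qed.

(** No entry precedes position 0, so the two faces there agree and cancel. *)
Lemma rack_boundary_genE n (x : n.-tuple X) :
  rack_boundary_gen x =
  \sum_(i < n) (-1) ^+ i.+1 *: (<< rack_face0 i x >> - << rack_face1 i x >>).
Proof.
rewrite /rack_boundary_gen [RHS](bigID (fun i : 'I_n => (0 < i)%N)) /=.
rewrite [X in _ + X]big1 ?addr0 // => i; rewrite -eqn0Ngt => /eqP i0.
suff -> : rack_face0 i x = rack_face1 i x by rewrite subrr scaler0.
by apply: eq_mktuple => l; rewrite i0.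
Qed.

(** Removing [u] gives the leading term. The other positions are numbered by the faces of [x]: those
    before [j] cancel, and [i >= j] stands for position [i + 1] of the insertion, of sign (-1)^(i+2)
    = (-1)^i. *)
Lemma boundary_insertion m j a u (x : m.+1.-tuple X) :
    (0 < j <= m.+1)%N ->
  rack_boundary_gen (insertion j a u x) =
  (-1) ^+ j.+1 *: (<< collapse j a x >> - << collapse j (rack_op a u) x >>) +
  \sum_(i < m.+1) (-1) ^+ i *: (if (i < j)%N then 0 else
    << insertion j a u (rack_face0 i x) >> -
    << insertion j (rack_op a (tnth x i)) (rack_op u (tnth x i))
         (rack_face1 i x) >>).
Proof.
move=> /andP[j_gt0 le_jm]; have lt_jm : (j < m.+2)%N by [].
rewrite rack_boundary_genE (@bigD1_ord _ _ _ _ (Ordinal lt_jm)) //=.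
rewrite face0_insertion_eq // face1_insertion_eq //; congr (_ + _).
apply: eq_bigr => i _ /=; rewrite /bump.
case: (ltnP i j) => [lt_ij | le_ji].
  rewrite face0_insertion_lt /= /bump ?subrr ?scaler0 //; lia.
rewrite (@face0_insertion_gt _ _ _ _ _ _ i) /= /bump ?le_ji //.
rewrite (@face1_insertion_gt _ _ _ _ _ _ i) /= /bump ?le_ji //.
by rewrite add1n !exprS !mulN1r opprK.
Qed.

(* [F x y] is the pair of the entry repeated in the first [j] places and the
   one inserted after them. *)
Definition homotopy_gen j (F : seq X -> X -> X * X) n (x : n.-tuple X) :
  rack_chain X n.+1 :=
  \sum_y << insertion j (F x y).1 (F x y).2 x >>.

Definition homologous n (c c' : {freeg (n.-tuple X) / int}) : Prop :=
  exists w : rack_chain X n.+1, rack_boundary w = c - c'.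

Lemma homologous_trans n (c2 c1 c3 : {freeg (n.-tuple X) / int}) :
  homologous c1 c2 -> homologous c2 c3 -> homologous c1 c3.
Proof.
move=> [w dw] [v dv]; exists (w + v).
by rewrite raddfD /= dw dv addrA subrK.
Qed.

Section InsertionHomotopy.

Variables (j m : nat) (F : seq X -> X -> X * X).
Hypothesis j_bound : (0 < j <= m.+1)%N.
(** Faces before [j] are absent from the boundary of an insertion, so they must cancel under the
    homotopy itself. For later faces only the sums over [y] have to agree, which leaves room for
    reindexing. *)
Hypothesis F_lt : forall (x : m.+1.-tuple X) (i : 'I_m.+1), (i < j)%N ->
  homotopy_gen j F (rack_face0 i x) = homotopy_gen j F (rack_face1 i x).
Hypothesis F_ge : forall (x : m.+1.-tuple X) (i : 'I_m.+1), (j <= i)%N ->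
  \sum_y (<< insertion j (F x y).1 (F x y).2 (rack_face0 i x) >> -
          << insertion j (rack_op (F x y).1 (tnth x i))
               (rack_op (F x y).2 (tnth x i)) (rack_face1 i x) >>) =
  homotopy_gen j F (rack_face0 i x) - homotopy_gen j F (rack_face1 i x).

Lemma homotopy_formula (x : m.+1.-tuple X) :
  rack_boundary (homotopy_gen j F x) +
    fglift (@homotopy_gen j F m) (rack_boundary_gen x) =
  (-1) ^+ j.+1 *: (\sum_y << collapse j (F x y).1 x >> -
    \sum_y << collapse j (rack_op (F x y).1 (F x y).2) x >>).
Proof.
rewrite raddf_sum /=.
under eq_bigr => y _ do
  rewrite /rack_boundary liftU scale1r boundary_insertion //.
rewrite big_split exchange_big /= -scaler_sumr sumrB.
rewrite -[RHS]addr0 -addrA; congr (_ + _).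
rewrite rack_boundary_genE raddf_sum -big_split big1 //= => i _.
rewrite -scaler_sumr raddf_scalez raddfB /= !liftU !scale1r.
(* Face [i] has sign (-1)^(i+1) in the boundary of [x] but (-1)^i in that of the insertion, so the
   two contributions are subtracted. *)
rewrite exprS mulN1r scaleNr -scalerBr.
case: ltnP => [lt_ij | le_ji].
  by rewrite F_lt // big1 // !subrr scaler0.
by rewrite F_ge // subrr scaler0.
Qed.

Lemma homotopy_homologous (z : rack_chain X m.+1) : rack_boundary z = 0 ->
  homologous
    (fglift (fun x : m.+1.-tuple X => \sum_y << collapse j (F x y).1 x >>) z)
    (fglift (fun x : m.+1.-tuple X =>
       \sum_y << collapse j (rack_op (F x y).1 (F x y).2) x >>) z).
Proof.
move=> dz.
(* This sign undoes the one in [homotopy_formula]. *)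
exists ((-1) ^+ j.+1 *: fglift (@homotopy_gen j F _) z).
have dz0 : fglift (@homotopy_gen j F m) (rack_boundary z) = 0.
  by rewrite dz raddf0.
(* The vanishing term [dz0] is added so that [homotopy_formula] applies generator by generator. *)
rewrite raddf_scalez -[X in _ *: X]addr0 -[X in _ + X]dz0.
rewrite !raddf_fglift !fgliftE -!big_split scaler_sumr /=.
apply: eq_bigr => x _.
rewrite -!scalerDr scalerA mulrC -scalerA; congr (_ *: _).
by rewrite homotopy_formula scalerA -expr2 sqrr_sign scale1r.
Qed.

End InsertionHomotopy.

(** The two faces differ only before position [i], and those entries are overwritten by [a]. *)
Lemma insertion_faces j m a u (x : m.+1.-tuple X) (i : 'I_m.+1) :
  (i <= j)%N ->
  insertion j a u (rack_face0 i x) = insertion j a u (rack_face1 i x).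
Proof.
move=> le_ij; apply: (@eq_tuple_nth _ x0) => k lt_km.
rewrite !nth_insertion //; case: ltngtP => // lt_jk.
by rewrite nth_face0 nth_face1; case: ltnP => //; lia.
Qed.

(** * The two homotopies for a finite quasigroup quandle, and their composition *)

Hypothesis rack_op_inj : forall a : X, injective (rack_op a).

Lemma reindex_rack_op (V : nmodType) b (G : X -> V) :
  \sum_y G (rack_op y b) = \sum_y G y.
Proof. by rewrite [RHS](reindex _ (onW_bij _ (rack_op_bij b))). Qed.

Lemma homologous_collapse_average j m (z : rack_chain X m.+1) :
    (0 < j <= m.+1)%N -> rack_boundary z = 0 ->
  homologous
    (fglift (fun x : m.+1.-tuple X =>
       << collapse j (nth x0 x j.-1) x >> *+ #|X|) z)
    (fglift (fun x : m.+1.-tuple X => \sum_y << collapse j y x >>) z).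
Proof.
move=> j_bound dz.
pose F s y := (nth x0 s j.-1, y : X).
have := @homotopy_homologous j m F j_bound _ _ z dz.
have -> : (fun x : m.+1.-tuple X => \sum_y << collapse j (F x y).1 x >>) =
  (fun x : m.+1.-tuple X => << collapse j (nth x0 x j.-1) x >> *+ #|X|)
    :> (_ -> {freeg (m.+1.-tuple X) / int}).
  by apply/funext => x; rewrite -sumr_const; apply: eq_bigl.
have -> : (fun x : m.+1.-tuple X =>
      \sum_y << collapse j (rack_op (F x y).1 (F x y).2) x >>) =
    (fun x : m.+1.-tuple X => \sum_y << collapse j y x >>)
    :> (_ -> {freeg (m.+1.-tuple X) / int}).
  apply/funext => x; rewrite /= [RHS](reindex (rack_op (nth x0 x j.-1))) //.
  (* Left translation is injective on a finite set, hence a permutation. *)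
  by apply: onW_bij; apply: injF_bij.
apply=> x i.
  move=> lt_ij; apply: eq_bigr => y _; rewrite /= nth_face0 nth_face1.
  by case: ltnP; [lia | rewrite insertion_faces // ltnW].
move=> le_ji; rewrite sumrB; congr (_ - _); rewrite /homotopy_gen /=.
  by rewrite nth_face0; case: ltnP; first by []; lia.
rewrite nth_face1 (tnth_nth x0); case: ltnP; last lia.
move=> _.
(* The action of the removed entry only permutes the values of [y]. *)
exact: (@reindex_rack_op _ _ (fun y => << insertion j _ y (rack_face1 i x) >>)).
Qed.

Lemma homologous_average_collapse j m (z : rack_chain X m.+1) :
    (0 < j < m.+1)%N -> rack_boundary z = 0 ->
  homologous
    (fglift (fun x : m.+1.-tuple X => \sum_y << collapse j y x >>) z)
    (fglift (fun x : m.+1.-tuple X =>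
       << collapse j.+1 (nth x0 x j) x >> *+ #|X|) z).
Proof.
move=> /andP[j_gt0 lt_jm] dz.
have j_bound : (0 < j <= m.+1)%N by rewrite j_gt0 ltnW.
(* Left division: [ldiv y b] is the [u] with y * u = b. *)
pose ldiv y := invF (@rack_op_inj y).
have ldivM c y b : rack_op (ldiv y b) c = ldiv (rack_op y c) (rack_op b c).
  (* Right translation by [c] is a homomorphism, so it carries the solution of one division to that
     of the translated one. *)
  apply: (@rack_op_inj (rack_op y c)).
  by rewrite -rack_op_dist !f_invF.
pose F s y := (y, ldiv y (nth x0 s j)).
have := @homotopy_homologous j m F j_bound _ _ z dz.
have -> : (fun x : m.+1.-tuple X =>
      \sum_y << collapse j (rack_op (F x y).1 (F x y).2) x >>) =
  (fun x : m.+1.-tuple X => << collapse j.+1 (nth x0 x j) x >> *+ #|X|)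
    :> (_ -> {freeg (m.+1.-tuple X) / int}).
  apply/funext => x; rewrite -sumr_const; apply: eq_big => // y _.
  (* The repeated entry is now the one already at position [j], so [j] copies make [j.+1]. *)
  rewrite f_invF; congr << _ >>; apply: (@eq_tuple_nth _ x0) => k lt_km.
  by rewrite !nth_collapse // ltnS; case: ltngtP => // ->.
apply=> x i.
  move=> lt_ij; apply: eq_bigr => y _; rewrite /= nth_face0 nth_face1.
  by case: ltnP; [lia | rewrite insertion_faces // ltnW].
move=> le_ji; rewrite sumrB /=.
(* By [ldivM] the summand depends on [y] only through its translate by [tnth x i], which can be
   taken as the new variable. *)
under [X in _ - X]eq_bigr => y _ do rewrite ldivM.
rewrite (@reindex_rack_op _ (tnth x i) (fun y => << insertion j y
  (ldiv y (rack_op (nth x0 x j) (tnth x i))) (rack_face1 i x) >>)).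
rewrite /homotopy_gen /= nth_face0 nth_face1 (tnth_nth x0).
move: le_ji; rewrite leq_eqVlt => /orP[/eqP ij | -> //].
(* Both sides vanish when the entry removed is [x_(j+1)] itself. *)
rewrite -ij ltnn rack_opxx.
have ins_faces b c : insertion j b c (rack_face0 i x) =
  insertion j b c (rack_face1 i x) by apply: insertion_faces; rewrite ij.
under eq_bigr do rewrite ins_faces.
rewrite subrr.
under eq_bigr do rewrite ins_faces.
by rewrite subrr.
Qed.

Lemma homologous_mulr_card j m (z : rack_chain X m.+1) :
    (j <= m)%N -> rack_boundary z = 0 ->
  homologous (z *+ #|X|)
    (fglift (fun x : m.+1.-tuple X => \sum_y << collapse j.+1 y x >>) z).
Proof.
move=> + dz; elim: j => [|j IHj] le_jm; last first.
  (* The chain is S_(j+1) ~ #|X| T_(j+2) ~ S_(j+2). *)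
  apply: (homologous_trans (IHj (ltnW le_jm))).
  apply: (homologous_trans (homologous_average_collapse _ dz)) => //.
  exact: homologous_collapse_average.
have -> : z *+ #|X| = fglift (fun x : m.+1.-tuple X =>
    << collapse 1 (nth x0 x 0) x >> *+ #|X|) z.
  rewrite -[in LHS](freeg_sumE z) fgliftE -sumrMnl; apply: eq_bigr => x _.
  have -> : collapse 1 (nth x0 x 0) x = x.
    apply: (@eq_tuple_nth _ x0) => k lt_km; rewrite nth_collapse //.
    by case: k lt_km.
  by rewrite -scalerMnr -[coeff x z in RHS]intz scaler_int freegU_mulz intz.
exact: homologous_collapse_average.
Qed.

(** Every boundary is a combination of differences of two generators. *)
Lemma deg_rack_boundary n (w : rack_chain X n) : deg (rack_boundary w) = 0.
Proof.
rewrite /rack_boundary fgliftE raddf_sum big1 //= => x _.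
rewrite /deg raddf_scalez raddf_sum big1 ?scaler0 //= => i _.
by rewrite raddf_scalez raddfB /= !liftU subrr scaler0.
Qed.

Lemma torsion_cycle_mulr_card m p (z : rack_chain X m.+1)
    (w : rack_chain X m.+2) :
    rack_boundary z = 0 -> (0 < p)%N -> rack_boundary w = z *+ p ->
  homologous (z *+ #|X|) 0.
Proof.
(* The degree of [z *+ p] is that of a boundary, and the integers have no torsion. *)
move=> dz p_gt0 dw; have deg_z : deg z = 0.
  apply/eqP; have := deg_rack_boundary w; rewrite dw raddfMn /= => /eqP.
  by rewrite Num.Theory.mulrn_eq0 eqn0Ngt p_gt0.
have := homologous_mulr_card (leqnn m) dz.
have -> // :
  fglift (fun x : m.+1.-tuple X => \sum_y << collapse m.+1 y x >>) z = 0.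
pose c : {freeg (m.+1.-tuple X) / int} := \sum_y << nseq_tuple m.+1 y >>.
(* Collapsing all entries forgets [x]: every generator goes to the same chain [c]. *)
transitivity (deg z *: c); last by rewrite deg_z scale0r.
rewrite /deg !fgliftE scaler_suml; apply: eq_bigr => x _.
rewrite -scalerA scale1r; congr (_ *: _); apply: eq_bigr => y _; congr << _ >>.
apply: (@eq_tuple_nth _ x0) => k lt_km.
by rewrite nth_collapse // nth_nseq lt_km.
Qed.

Theorem torsion_rack_homology_mulr_card n (h : rack_homology X n.+1) :
  torsion h -> h *+ #|X| = 0.
Proof.
apply: torsion_homology => z p w dz p_gt0 dw.
have [v] := torsion_cycle_mulr_card dz p_gt0 dw.
by rewrite subr0; exists v.
Qed.

End Homotopy.

(** * The dihedral quandle of order 3 *)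

Lemma dihedral_opxx k (a : dihedral k) : rack_op a a = a.
Proof. by rewrite /rack_op /= /dihedral_op mulr2n addrK. Qed.

(** Modulo 3 doubling is negation, hence injective. *)
Lemma dihedral3_op_inj (a : dihedral 3) : injective (rack_op a).
Proof.
move=> b c /addIr.
have dbl (e : dihedral 3) : e *+ 2 = - e.
  by apply/eqP; case: e => [[|[|[|//]]] e_lt].
by rewrite !dbl => /oppr_inj.
Qed.

Theorem theorem4p2 (q n : nat) (hq : q = 3) (hn : (1 < n)%N)
    (h : rack_homology (dihedral q) n) :
  torsion h -> (h *+ q = 0)%R.
Proof.
case: n hn h => // n _ h; subst q.
have card3 : #|{: dihedral 3}| = 3 by rewrite card_ord.
rewrite -[X in h *+ X]card3.
apply: (@torsion_rack_homology_mulr_card (dihedral 3 : finRackType) 0).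
- exact: dihedral_opxx.
- exact: dihedral3_op_inj.
Qed.
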